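(* Let $m \geq 1$ be an integer. Let $T \subseteq \{0,1\}^m$ be a maximum $3$-wise intersecting family, i.e. a $3$-wise intersecting family whose cardinality is largest among all $3$-wise intersecting families in $\{0,1\}^m$. Then $T$ is a star; that is, there exist an index $j \in \{1,\dots,m\}$ and a letter $a \in \{0,1\}$ such that $T = \{(x_1,\dots,x_m) \in \{0,1\}^m : x_j = a\}$.
   Context: A binary word of length $m$ is an element $\mathbf{x} = (x_1,\dots,x_m)$ of $\{0,1\}^m$. A collection $T \subseteq \{0,1\}^m$ is $3$-wise intersecting if every three elements of $T$ share at least one common bit at the same index: for all $\mathbf{x}, \mathbf{y}, \mathbf{z} \in T$ (not necessarily distinct) there is an index $j \in \{1,\dots,m\}$ with $x_j = y_j = z_j$. In particular, any two words of a $3$-wise intersecting family agree in at least one coordinate. A star in $\{0,1\}^m$ is the set of all words having a fixed letter at a fixed coordinate. *)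

(* Defs.v *)
From mathcomp Require Import all_boot.

Set Implicit Arguments.
Unset Strict Implicit.
Unset Printing Implicit Defensive.

Notation word m := (m.-tuple bool).

Definition three_wise_intersecting (m : nat) (T : {set word m}) : Prop :=
  forall x y z : word m, x \in T -> y \in T -> z \in T ->
    exists j : 'I_m, tnth x j = tnth y j /\ tnth y j = tnth z j.

Definition maximum_three_wise_intersecting (m : nat) (T : {set word m}) : Prop :=
  three_wise_intersecting T /\
  forall S : {set word m}, three_wise_intersecting S -> #|S| <= #|T|.

Definition star (m : nat) (j : 'I_m) (a : bool) : {set word m} :=
  [set x : word m | tnth x j == a].

(* Main.v *)
Require Import Defs.
From mathcomp Require Import all_boot.

(** Comparing with a star, a maximum family [T] has at least [2^(m-1)] words;
    since it never contains a word together with its complement, it contains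
    exactly one word of each complementary pair.  If [x, y] are in [T], a word
    [w] equal to [x] wherever [x] and [y] agree is in [T], as otherwise its
    complement is in [T] and has no coordinate in common with both [x] and [y].
    Choose [x, y] in [T] agreeing on a set [A] of minimal size.  For [z] in [T],
    the word equal to [x] on [A] and to the complement of [z] elsewhere is in
    [T] and agrees with [z] only inside [A], hence on all of [A] by minimality.
    So all words of [T] agree on the nonempty set [A]. *)

Definition compl_word {m : nat} (x : word m) : word m :=
  [tuple ~~ tnth x j | j < m].

Definition agreement {m : nat} (x y : word m) : {set 'I_m} :=
  [set j | tnth x j == tnth y j].

Lemma compl_wordK {m : nat} : involutive (@compl_word m).
Proof. by move=> x; apply: eq_from_tnth => j; rewrite !tnth_mktuple negbK. Qed.

Lemma compl_word_notin {m : nat} {T : {set word m}} {x : word m} :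
  three_wise_intersecting T -> x \in T -> compl_word x \notin T.
Proof.
move=> hT xT; apply/negP => cxT.
have [j [+ _]] := hT _ _ _ xT cxT cxT.
by rewrite tnth_mktuple; case: (tnth x j).
Qed.

Lemma star_three_wise_intersecting {m : nat} (j : 'I_m) (a : bool) :
  three_wise_intersecting (star j a).
Proof.
by move=> x y z; rewrite !inE => /eqP xj /eqP yj /eqP zj; exists j; rewrite xj yj zj.
Qed.

(** Complementing words carries the star onto its set complement, so each is half of all words. *)
Lemma card_star {m : nat} (j : 'I_m) (a : bool) :
  (#|star j a|).*2 = #|{: word m}|.
Proof.
rewrite -(cardsC (star j a)) -addnn; congr (_ + _).
rewrite -(card_preimset _ (inv_inj (@compl_wordK _))); congr #|pred_of_set _|.
by apply/setP => x; rewrite !inE tnth_mktuple; case: (tnth x j); case: a.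
Qed.

Lemma maximum_compl_word_in {m : nat} {T : {set word m}} {x : word m} :
  0 < m -> maximum_three_wise_intersecting T -> x \notin T -> compl_word x \in T.
Proof.
move=> m_gt0 [hT maxT].
have sub : @compl_word m @^-1: T \subset ~: T.
  by apply/subsetP => y; rewrite !inE; apply: contraL; exact: compl_word_notin.
suff /eqP eqT : @compl_word m @^-1: T == ~: T.
  by move=> xNT; move/setP/(_ x): eqT; rewrite !inE xNT.
rewrite eqEcard sub card_preimset; last exact: inv_inj (@compl_wordK _).
(* It remains that [T] holds at least half of all words, as a star does; [0 < m] provides a
   coordinate for that star. *)
rewrite -(leq_add2l #|T|) cardsC addnn -(card_star (Ordinal m_gt0) true) leq_double.
exact/maxT/star_three_wise_intersecting.
Qed.

Lemma maximum_agreement_closed {m : nat} {T : {set word m}} {x y w : word m} :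
  0 < m -> maximum_three_wise_intersecting T -> x \in T -> y \in T ->
  agreement x y \subset agreement x w -> w \in T.
Proof.
move=> m_gt0 hT xT yT /subsetP sub.
apply/negPn/negP => /(maximum_compl_word_in m_gt0 hT) cwT.
have [j [xy]] := proj1 hT _ _ _ xT yT cwT.
have := sub j; rewrite !inE xy eqxx tnth_mktuple => /(_ isT) /eqP ->.
by case: (tnth w j).
Qed.

Theorem theorem1p3 (m : nat) (hm : 1 <= m) (T : {set word m})
  (hT : maximum_three_wise_intersecting T) :
  exists (j : 'I_m) (a : bool), T = star j a.
Proof.
have [x0 x0T] : exists x0, x0 \in T.
  pose u : word m := [tuple true | _ < m].
  case: (boolP (u \in T)) => [uT|/(maximum_compl_word_in hm hT) uT]; first by exists u.
  by exists (compl_word u).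
pose inT (p : word m * word m) := (p.1 \in T) && (p.2 \in T).
have inT0 : inT (x0, x0) by rewrite /inT x0T.
case: (arg_minnP (fun p => #|agreement p.1 p.2|) inT0) => -[x y] /andP[/= xT yT] min_xy.
have [j [xy _]] := proj1 hT _ _ _ xT yT yT.
exists j, (tnth x j); apply/eqP; rewrite eqEcard.
(* Maximality gives [#|star| <= #|T|], so one inclusion suffices. *)
apply/andP; split; last exact/(proj2 hT)/star_three_wise_intersecting.
apply/subsetP => z zT; rewrite inE.
pose w : word m := [tuple if k \in agreement x y then tnth x k else ~~ tnth z k | k < m].
have wT : w \in T.
  apply: (maximum_agreement_closed hm hT xT yT).
  by apply/subsetP => k kA; rewrite inE tnth_mktuple kA.
have wz_sub : agreement w z \subset agreement x y.
  apply/subsetP => k; rewrite [k \in agreement w z]inE tnth_mktuple.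
  by case: ifP => // _; case: (tnth z k).
have wz_eq : agreement w z = agreement x y.
  by apply/eqP; rewrite eqEcard wz_sub (min_xy (w, z)) // /inT wT.
have jA : j \in agreement x y by rewrite inE xy.
(* At [j], [w] agrees with [z] and copies [x]. *)
by move: (jA); rewrite -{1}wz_eq inE tnth_mktuple jA eq_sym.
Qed.
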